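(* Let $k\ge 1$ and $n\ge k+1$ be integers, let $Z$ be a real $n\times(k+1)$ matrix of full rank $k+1$, and let $\tilde Z:\mathrm{Gr}(k,n)\dashrightarrow \mathrm{Gr}(k,k+1)$ be the rational map $[A]\mapsto[AZ]$. Then, identifying $\mathrm{Gr}(k,k+1)$ with $\mathbb{P}^k$ via the Plücker embedding, the open Grasstope $\tilde Z(\mathrm{Gr}_{>0}(k,n))$ satisfies $$\tilde Z(\mathrm{Gr}_{>0}(k,n))=\{\mathbf{x}\in\mathbb{P}^k : \mathrm{var}(L(\mathbf{x}))\ge k\},$$ where $L(\mathbf{x})$ is the vector of twistor coordinates of $\mathbf{x}$ with respect to $Z$.
   Context: $\mathrm{Gr}(k,n)$ is the real Grassmannian of $k$-dimensional subspaces of $\mathbb{R}^n$; a point is written $[A]$, the row span of a $k\times n$ matrix $A$ of rank $k$. The Plücker coordinates of $[A]$ are the maximal minors of $A$, up to common scaling. $\mathrm{Gr}_{>0}(k,n)\subset \mathrm{Gr}(k,n)$ is the set of points whose Plücker coordinates are all nonzero and all have the same sign. The map $\tilde Z$ is not assumed to be defined on all of $\mathrm{Gr}_{>0}(k,n)$: its base locus is $\mathcal{B}(\tilde Z)=\{V\in\mathrm{Gr}(k,n):\dim(V\cap\ker Z^T)\ge1\}$ (equivalently the set of $[A]$ with $AZ$ of rank less than $k$), and $\tilde Z(\mathrm{Gr}_{>0}(k,n))$ denotes the image of $\mathrm{Gr}_{>0}(k,n)\setminus\mathcal{B}(\tilde Z)$. Identification $\mathrm{Gr}(k,k+1)\cong\mathbb{P}^k$: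 a hyperplane $X=\mathrm{Span}\{w_1,\dots,w_k\}\subset\mathbb{R}^{k+1}$ corresponds to the point $\mathbf{x}\in\mathbb{P}^k$ whose homogeneous coordinates are its Plücker coordinates $p_{1\cdots\hat{j}\cdots k+1}$, $j=1,\dots,k+1$ (the $k\times k$ minors of the matrix with rows $w_1,\dots,w_k$, omitting column $j$); every point of $\mathbb{P}^k$ arises this way from a unique $X$. Twistor coordinates: for $v\in\mathbb{R}^{k+1}$ put $T(\mathbf{x},v)=\det[w_1\,|\cdots|\,w_k\,|\,v]=\sum_{j=1}^{k+1}(-1)^{k+1-j}p_{1\cdots\hat{j}\cdots k+1}\,v_j$. Let $Z_1,\dots,Z_n$ be the rows of $Z$ and $l_i(\mathbf{x})=T(\mathbf{x},Z_i)$. Then $L(\mathbf{x})=(l_1(\mathbf{x}):\dots:l_n(\mathbf{x}))\in\mathbb{P}^{n-1}$. Sign variation: for $v\in\mathbb{R}^n$, $\mathrm{var}(v)$ is the number of sign changes in the sequence $v_1,\dots,v_n$, ignoring zeros; it is invariant under nonzero scaling of $v$. *)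

(* Defs.v *)
From HB Require Import structures.
From mathcomp Require Import all_boot all_order all_algebra.
From mathcomp Require Import boolp classical_sets reals.
From mathcomp Require Import qe_rcf_th.

Set Implicit Arguments.
Unset Strict Implicit.
Unset Printing Implicit Defensive.

Import Order.TTheory GRing.Theory Num.Theory.
Local Open Scope ring_scope.
Local Open Scope classical_set_scope.

Definition Gr (R : realType) (k n : nat) : Type :=
  {V : {vspace 'rV[R]_n} | \dim V == k}.

(* Lines in R^n, i.e. the projective space of dimension n - 1: the space P^k
   is [Proj R k.+1], and P^(n-1) is [Proj R n]. *)
Definition Proj (R : realType) (n : nat) : Type := Gr R 1 n.

Definition rowspan (R : realType) (m n : nat) (A : 'M[R]_(m, n)) :
  {vspace 'rV[R]_n} := <<[seq row i A | i : 'I_m]>>%VS.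

(* For increasing I, the Plucker coordinate p_I of [A]. *)
Definition minor (R : realType) (k n : nat) (I : 'I_k -> 'I_n)
  (A : 'M[R]_(k, n)) : R := \det (colsub I A).

Definition increasing (k n : nat) (I : 'I_k -> 'I_n) : Prop :=
  {homo I : i j / (i < j)%N}.

Definition Gr_pos (R : realType) (k n : nat) : set (Gr R k n) :=
  [set V | exists2 A : 'M[R]_(k, n), rowspan A = val V &
     (forall I, increasing I -> 0 < minor I A) \/
     (forall I, increasing I -> minor I A < 0)].

(* Right multiplication v |-> v Z on row vectors; its kernel is ker Z^T. *)
Definition rmul (R : realType) (n m : nat) (Z : 'M[R]_(n, m)) :
  'Hom('rV[R]_n, 'rV[R]_m) := linfun (mulmxr Z : 'rV[R]_n -> 'rV[R]_m).

Definition base_locus (R : realType) (k n m : nat) (Z : 'M[R]_(n, m)) :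
  set (Gr R k n) :=
  [set V | (1 <= \dim (val V :&: lker (rmul Z)))%N].

(* The rational map [A] |-> [A Z], as a partial function: it is [None] exactly
   when the image of V has dimension less than k (see [Zmap_rowspan] and
   [base_locusP]). *)
Definition Zmap (R : realType) (k n m : nat) (Z : 'M[R]_(n, m))
  (V : Gr R k n) : option (Gr R k m) := insub (rmul Z @: val V)%VS.

Definition open_Grasstope (R : realType) (k n : nat) (Z : 'M[R]_(n, k.+1)) :
  set (Gr R k k.+1) :=
  [set X | exists2 V, (@Gr_pos R k n `\` @base_locus R k n k.+1 Z) V &
     Zmap Z V = Some X].

(* Entry j is the minor omitting column j. *)
Definition plucker_vec (R : realType) (k : nat) (W : 'M[R]_(k, k.+1)) :
  'rV[R]_k.+1 := \row_(j < k.+1) minor (lift j) W.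

(* With 0-based j, the exponent (k + 1) - (j + 1) is k - j. *)
Definition twistor (R : realType) (k : nat) (x v : 'rV[R]_k.+1) : R :=
  \sum_(j < k.+1) (-1) ^+ (k - j) * x 0 j * v 0 j.

Definition twistor_vec (R : realType) (k n : nat) (Z : 'M[R]_(n, k.+1))
  (x : 'rV[R]_k.+1) : 'rV[R]_n := \row_i twistor x (row i Z).

Definition svar (R : realType) (n : nat) (v : 'rV[R]_n) : nat :=
  changes [seq a <- [seq v 0 i | i : 'I_n] | a != 0].

Section RowSpan.
Variable R : realType.
Implicit Types k m n : nat.

Lemma mem_rowspan m n (A : 'M[R]_(m, n)) (v : 'rV[R]_n) :
  (v \in rowspan A) = (v <= A)%MS.
Proof.
apply/idP/idP => [|/submxP[D ->]].
  move=> /(@coord_span _ _ _ (in_tuple _)) ->; apply: summx_sub => i _.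
  apply: scalemx_sub; set s := in_tuple _.
  have : s`_i \in s by rewrite mem_nth // size_tuple.
  by case/mapP => j _ ->; exact: row_sub.
rewrite mulmx_sum_row; apply: rpred_sum => i _; apply: memvZ.
by apply: memv_span; apply/mapP; exists i; rewrite ?mem_enum.
Qed.

Lemma rowspan_eq m1 m2 n (A : 'M[R]_(m1, n)) (B : 'M[R]_(m2, n)) :
  (rowspan A = rowspan B) <-> (A :=: B)%MS.
Proof.
split=> [AB|AB]; last by apply/vspaceP => v; rewrite !mem_rowspan AB.
apply/eqmxP/andP; split; apply/rV_subP => v.
  by rewrite -!mem_rowspan AB.
by rewrite -!mem_rowspan AB.
Qed.

Lemma dim_rowspan m n (A : 'M[R]_(m, n)) : \dim (rowspan A) = \rank A.
Proof.
have -> : rowspan A = rowspan (row_base A).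
  by apply/rowspan_eq/eqmx_sym/eq_row_base.
set B := row_base A; have Bf : row_free B by exact: row_base_free.
have sz : size [seq row i B | i : 'I_(\rank A)] == \rank A.
  by rewrite size_map -cardE card_ord.
pose X := Tuple sz.
have Xi (i : 'I_(\rank A)) : X`_i = row i B.
  by rewrite /= (nth_map i) ?size_enum_ord // nth_ord_enum.
suff /eqP : free X by rewrite size_tuple => dX; exact: dX.
apply/freeP => c c0 i.
have : (\row_i c i) *m B = 0 *m B.
  rewrite mul0mx mulmx_sum_row -[RHS]c0; apply: eq_bigr => j _.
  by rewrite mxE Xi.
by move/(row_free_inj Bf)/rowP/(_ i); rewrite !mxE.
Qed.

Lemma rmul_rowspan m n p (A : 'M[R]_(m, n)) (Z : 'M[R]_(n, p)) :
  (rmul Z @: rowspan A)%VS = rowspan (A *m Z).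
Proof.
apply/vspaceP => v; rewrite mem_rowspan; apply/idP/idP.
  by case/memv_imgP => u; rewrite mem_rowspan lfunE /= => uA ->; exact: submxMr.
case/submxP => D ->; rewrite mulmxA.
have -> : D *m A *m Z = rmul Z (D *m A) by rewrite lfunE.
by apply: memv_img; rewrite mem_rowspan submxMl.
Qed.

(* The point [A]. *)
Definition bracket k n (A : 'M[R]_(k, n)) (rkA : \rank A = k) : Gr R k n :=
  exist _ (rowspan A) (introT eqP (etrans (dim_rowspan A) rkA)).

Lemma Zmap_rowspan k n m (Z : 'M[R]_(n, m)) (A : 'M[R]_(k, n))
  (rkA : \rank A = k) (rkAZ : \rank (A *m Z) = k) :
  Zmap Z (bracket rkA) = Some (bracket rkAZ).
Proof.
have dV : \dim (rowspan (A *m Z)) == k by rewrite dim_rowspan rkAZ.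
rewrite /Zmap /= rmul_rowspan (insubT (fun V => \dim V == k) dV); congr Some.
exact: val_inj.
Qed.

Lemma base_locusP k n m (Z : 'M[R]_(n, m)) (V : Gr R k n) :
  base_locus Z V <-> Zmap Z V = None.
Proof.
have := limg_ker_dim (rmul Z) (val V); rewrite (eqP (valP V)) => dV.
rewrite /base_locus /Zmap /=; case: insubP => [X /eqP e _|ne].
  by split => //; move: dV; rewrite e -[RHS]add0n => /addIn ->.
split=> // _; rewrite lt0n; apply: contraNN ne => /eqP d0.
by move: dV; rewrite d0 add0n => ->.
Qed.

Definition basis_mx k n (V : Gr R k n) : 'M[R]_(k, n) :=
  \matrix_(i < k) (vbasis (val V))`_i.

Lemma rowspan_basis_mx k n (V : Gr R k n) : rowspan (basis_mx V) = val V.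
Proof.
rewrite -[RHS](span_basis (vbasisP (val V))) /rowspan; congr <<_>>%VS.
have sz : size (vbasis (val V)) = k by rewrite size_tuple (eqP (valP V)).
apply: (@eq_from_nth _ 0) => [|i]; rewrite size_map -cardE card_ord ?sz // => ik.
by rewrite (nth_map (Ordinal ik)) ?size_enum_ord // rowK nth_enum_ord.
Qed.

Lemma rank_basis_mx k n (V : Gr R k n) : \rank (basis_mx V) = k.
Proof. by rewrite -dim_rowspan rowspan_basis_mx; exact/eqP/(valP V). Qed.

End RowSpan.

Section Twistor.
Variable R : realType.
Implicit Types k n : nat.

(* The matrix [w_1 | ... | w_k | v], with w_i the rows of W. *)
Definition twistor_mx k (W : 'M[R]_(k, k.+1)) (v : 'rV[R]_k.+1) :
  'M[R]_k.+1 :=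
  \matrix_(i, j) (if unlift ord_max j is Some j' then W j' i else v 0 i).

Lemma twistorE k (W : 'M[R]_(k, k.+1)) (v : 'rV[R]_k.+1) :
  twistor (plucker_vec W) v = \det (twistor_mx W v).
Proof.
rewrite (expand_det_col _ ord_max); apply: eq_bigr => j _.
rewrite !mxE unlift_none mulrC; congr (_ * _).
rewrite /cofactor /=; congr (_ * _).
  rewrite -signr_odd oddB -?oddD ?leq_ord // addnC signr_odd //.
rewrite /minor -det_tr; congr (\det _); apply/matrixP => a b.
by rewrite !mxE liftK.
Qed.

Lemma plucker_vec_neq0 k (W : 'M[R]_(k, k.+1)) :
  \rank W = k -> plucker_vec W != 0.
Proof.
move=> rkW; apply/eqP => p0.
have : ~~ (1%:M <= W)%MS.
  by apply/negP => /mxrankS; rewrite rkW mxrank1 ltnn.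
case/row_subPn => i; set v := row i _ => vW.
have : \det (twistor_mx W v) = 0.
  by rewrite -twistorE p0 /twistor big1 // => j _; rewrite mxE mulr0 mul0r.
rewrite -det_tr => /eqP; set M := (_^T)%R; apply/negP; rewrite -unitfE -unitmxE.
rewrite -row_free_unit -row_leq_rank.
have WM : (W + v <= M)%MS.
  rewrite addsmx_sub; apply/andP; split.
    apply/row_subP => a; have -> : row a W = row (lift ord_max a) M.
      by apply/rowP => b; rewrite !mxE liftK.
    exact: row_sub.
  have -> : v = row ord_max M by apply/rowP => b; rewrite ![RHS]mxE unlift_none.
  exact: row_sub.
apply: leq_trans (mxrankS WM).
suff : (W < W + v)%MS by rewrite ltmxErank rkW => /andP[].
by rewrite ltmxE addsmxSl addsmx_sub submx_refl.
Qed.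

Lemma plucker_vecM k (U : 'M[R]_k) (W : 'M[R]_(k, k.+1)) :
  plucker_vec (U *m W) = \det U *: plucker_vec W.
Proof.
apply/rowP => j; rewrite !mxE /minor -det_mulmx; congr (\det _).
by apply/matrixP => a b; rewrite !mxE; apply: eq_bigr => c _; rewrite !mxE.
Qed.

Lemma twistor_vec_neq0 k n (Z : 'M[R]_(n, k.+1)) (x : 'rV[R]_k.+1) :
  \rank Z = k.+1 -> x != 0 -> twistor_vec Z x != 0.
Proof.
move=> rkZ; apply: contraNN => /eqP t0.
pose y : 'rV[R]_k.+1 := \row_j ((-1) ^+ (k - j) * x 0 j).
have ZT : row_free Z^T by rewrite /row_free mxrank_tr rkZ.
have : y *m Z^T = 0 *m Z^T.
  rewrite mul0mx -[RHS]t0; apply/rowP => i; rewrite !mxE.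
  by apply: eq_bigr => j _; rewrite !mxE.
move/(row_free_inj ZT)/rowP => y0; apply/eqP/rowP => j.
by have := y0 j; rewrite !mxE => /eqP; rewrite mulf_eq0 signr_eq0 => /eqP.
Qed.

Definition proj_pt n (v : 'rV[R]_n) (v0 : v != 0) : Proj R n :=
  exist _ <[v]>%VS (introT eqP (etrans (dim_vline v) (congr1 nat_of_bool v0))).

(* A choice of homogeneous coordinates, unique up to scaling ([hcoord_pt]). *)
Definition hcoord n (x : Proj R n) : 'rV[R]_n := vpick (val x).

Lemma hcoord_neq0 n (x : Proj R n) : hcoord x != 0.
Proof. by rewrite /hcoord vpick0 -dimv_eq0 (eqP (valP x)). Qed.

Lemma hcoord_pt n (v : 'rV[R]_n) (v0 : v != 0) :
  exists2 a : R, a != 0 & hcoord (proj_pt v0) = a *: v.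
Proof.
have := memv_pick (val (proj_pt v0)); case/vlineP => a e.
exists a => //; have := hcoord_neq0 (proj_pt v0).
by rewrite /hcoord e; apply: contraNneq => ->; rewrite scale0r.
Qed.

(* The identification Gr(k,k+1) = P^k. *)
Definition plucker k (X : Gr R k k.+1) : Proj R k.+1 :=
  proj_pt (plucker_vec_neq0 (rank_basis_mx X)).

Lemma plucker_bracket k (W : 'M[R]_(k, k.+1)) (rkW : \rank W = k) :
  plucker (bracket rkW) = proj_pt (plucker_vec_neq0 rkW).
Proof.
apply: val_inj => /=; set B := basis_mx _.
have /rowspan_eq BW : rowspan B = rowspan W by rewrite rowspan_basis_mx.
have /submxP[U BU] : (B <= W)%MS by rewrite BW.
have BW0 := plucker_vec_neq0 (rank_basis_mx (bracket rkW)).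
move: BW0; rewrite -/B BU plucker_vecM => BW0.
have U0 : \det U != 0 by apply: contraNneq BW0 => ->; rewrite scale0r.
apply/eqP; rewrite eqEsubv -!memvE memvZ ?memv_line //=.
by apply/vlineP; exists (\det U)^-1; rewrite scalerA mulVf // scale1r.
Qed.

Definition twistor_pt k n (Z : 'M[R]_(n, k.+1)) (rkZ : \rank Z = k.+1)
  (x : Proj R k.+1) : Proj R n :=
  proj_pt (twistor_vec_neq0 rkZ (hcoord_neq0 x)).

Lemma svar_scale n (a : R) (v : 'rV[R]_n) : a != 0 -> svar (a *: v) = svar v.
Proof.
move=> a0; rewrite /svar.
have -> : [seq (a *: v) 0 i | i : 'I_n] = map ( *%R a) [seq v 0 i | i : 'I_n].
  by rewrite -map_comp; apply: eq_map => i; rewrite /= mxE.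
set s := map _ _; rewrite filter_map /=.
rewrite (@eq_filter _ _ (fun b : R => b != 0)); last first.
  by move=> b; rewrite /= mulf_eq0 (negPf a0).
elim: (filter _ _) => //= b t ->; congr (nat_of_bool _ + _)%N.
case: t => [|c t] /=; first by rewrite !mulr0.
rewrite mulrACA -expr2 pmulr_rlt0 //.
by rewrite exprn_even_gt0.
Qed.

(* Sign variation of a point of projective space; by [svar_scale] it does not
   depend on the homogeneous coordinates. *)
Definition svar_proj n (y : Proj R n) : nat := svar (hcoord y).

Lemma svar_proj_pt n (v : 'rV[R]_n) (v0 : v != 0) :
  svar_proj (proj_pt v0) = svar v.
Proof. by rewrite /svar_proj; have [a a0 ->] := hcoord_pt v0; exact: svar_scale. Qed.

Lemma svar_twistor_pt k n (Z : 'M[R]_(n, k.+1)) (rkZ : \rank Z = k.+1)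
  (x : 'rV[R]_k.+1) (x0 : x != 0) :
  svar_proj (twistor_pt rkZ (proj_pt x0)) = svar (twistor_vec Z x).
Proof.
rewrite svar_proj_pt; have [a a0 ->] := hcoord_pt x0.
rewrite -(svar_scale (twistor_vec Z x) a0); congr svar; apply/rowP => i; rewrite !mxE mulr_sumr.
by apply: eq_bigr => j _; rewrite !mxE !mulrA (mulrC a).
Qed.

End Twistor.

(* Main.v *)
(** If [Y = [AZ]] and [y] spans the orthogonal complement of [Y], the twistor
    coordinates are [l = Z y], so that [A l = 0].

    When all maximal minors of [A] have the same sign, a nonzero [l] in the
    kernel of [A] satisfies [var l >= k]: deleting the column at a zero of [l],
    or merging two adjacent columns at entries of [l] of the same sign, reduces
    to the case where [l] alternates.

    Conversely, if [var l >= k], rescale the columns of a Vandermonde matrix by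
    positive weights so that it kills [l]; a small perturbation, with rows still
    orthogonal to [l], then avoids the base locus. *)
Require Import Defs.
From mathcomp Require Import all_boot all_order all_algebra.
From mathcomp Require Import boolp classical_sets reals.
From mathcomp Require Import polyrcf qe_rcf_th ring lra zify.

Set Implicit Arguments.
Unset Strict Implicit.
Unset Printing Implicit Defensive.

Import Order.TTheory GRing.Theory Num.Theory.
Local Open Scope ring_scope.
Local Open Scope classical_set_scope.

(** * Sign variation and alternating subsequences *)

Definition alternating (R : realType) (k n : nat) (v : 'rV[R]_n)
  (I : 'I_k -> 'I_n) : Prop :=
  forall i j : 'I_k, j = i.+1 :> nat -> v 0 (I i) * v 0 (I j) < 0.

Lemma enum_ord_sorted n : sorted (fun i j : 'I_n => (i < j)%N) (enum 'I_n).
Proof. by have := iota_ltn_sorted 0 n; rewrite -val_enum_ord sorted_map. Qed.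

Section SignVariation.
Variable R : realType.

(** Since [(a b) (b c) = (a c) b^2], a negative [a c] forces a negative [a b] or [b c]. *)
Lemma changes_cons_le (a b : R) (s : seq R) :
  b != 0 -> (changes (a :: s) <= changes (a :: b :: s))%N.
Proof.
move=> b0; case: s => [|c s] /=; first by rewrite !mulr0 ltxx.
rewrite [leqRHS]addnA leq_add2r.
have [ab|ab] := ltP (a * b) 0; first by case: (_ < 0).
have [bc|bc] := ltP (b * c) 0; first by case: (_ < 0).
have b2 : 0 < b * b by rewrite -expr2 exprn_even_gt0.
suff /le_gtF -> : 0 <= a * c by [].
have := mulr_ge0 ab bc; have -> : a * b * (b * c) = a * c * (b * b) by ring.
by rewrite pmulr_lge0.
Qed.

(** Zeros are excluded because [changes] compares only neighbours: an inserted zero could hide a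
    sign change. *)
Lemma subseq_changes (s t : seq R) :
  all (fun a => a != 0) s -> subseq t s -> (changes t <= changes s)%N.
Proof.
have cons_le a (u : seq R) : (changes u <= changes (a :: u))%N by rewrite leq_addl.
(* Strengthening with a common head [a], kept while entries after it are dropped. *)
have sub a (u w : seq R) : all (fun b => b != 0) u -> subseq w u ->
    (changes (a :: w) <= changes (a :: u))%N.
  elim: u a w => [|b u IH] a [|c w] //= /andP[b0 u0].
    by move=> _; rewrite mulr0 ltxx.
  case: eqP => [->|_] wu; first by rewrite leq_add2l (IH b).
  exact: leq_trans (IH a _ u0 wu) (changes_cons_le a u b0).
elim: s t => [|b s IH] [|c t] // /andP[b0 s0] /=.
case: eqP => [->|_] ts; first exact: sub.
exact: leq_trans (IH (c :: t) s0 ts) (cons_le b s).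
Qed.

(* Greedy choice: from each block of entries of constant sign keep the first. *)
Lemma changes_subseq (T : eqType) (v : T -> R) (a : T) (e : seq T) (k : nat) :
  all (fun i => v i != 0) (a :: e) -> (k <= changes (map v (a :: e)))%N ->
  exists t, [/\ size t = k, subseq t e & path (fun i j => v i * v j < 0) a t].
Proof.
elim: e a k => [|b e IH] a [|k]; do ?by exists [::]; rewrite ?sub0seq.
  by rewrite /= mulr0 ltxx.
move=> /= /and3P[a0 b0 e0]; case: ltP => [ab|ab].
  rewrite add1n ltnS => /(IH b)[|t [<- te bt]]; first by rewrite /= b0.
  by exists (b :: t); rewrite /= eqxx ab.
(* Here [a] and [b] have the same sign, so [a] may replace [b] at the head of the sequence found
   from [b]. *)
rewrite add0n => /(IH b)[|t []]; first by rewrite /= b0.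
case: t => [//|c t] sz te /= /andP[bc ct].
exists (c :: t); split => //; first exact: subseq_trans te (subseq_cons _ _).
rewrite /= ct andbT.
have {}ab : 0 < v a * v b by rewrite lt_neqAle ab eq_sym mulf_neq0.
have b2 : 0 < v b * v b by rewrite -expr2 exprn_even_gt0.
have : v a * v b * (v b * v c) < 0 by rewrite pmulr_rlt0.
have -> : v a * v b * (v b * v c) = v a * v c * (v b * v b) by ring.
by rewrite pmulr_llt0.
Qed.

Lemma changes_path (a : R) (t : seq R) :
  path (fun b c => b * c < 0) a t ->
  all (fun b => b != 0) t /\ changes (a :: t) = size t.
Proof.
elim: t a => [|b t IH] a /=; first by rewrite mulr0 ltxx.
move=> /andP[ab /IH[t0 /= ->]]; rewrite ab t0 andbT; split=> //.
by apply: contraTneq ab => ->; rewrite mulr0 ltxx.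
Qed.

(** The entries selected by [I] form a subsequence with [k] changes, so [subseq_changes] applies. *)
Lemma svar_alternating (k n : nat) (v : 'rV[R]_n) (I : 'I_k.+1 -> 'I_n) :
  increasing I -> alternating v I -> (k <= svar v)%N.
Proof.
(* For [k = 0] the bound is trivial; otherwise alternation makes every selected entry nonzero. *)
case: k I => // k I; move=> incI altI; set s := [seq v 0 (I i) | i : 'I_k.+2].
have sI : subseq [seq I i | i : 'I_k.+2] (enum 'I_n).
  rewrite (_ : [seq _ | i : _] = [seq j <- enum 'I_n | j \in codom I]);
    first exact: filter_subseq.
  have tr : transitive (fun i j : 'I_n => i < j)%N by move=> ? ? ?; exact: ltn_trans.
  apply: (irr_sorted_eq tr) => [i||| i].
  - exact: ltnn.
  - by apply: homo_sorted (enum_ord_sorted _) => i j /incI.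
  - exact/sorted_filter/enum_ord_sorted.
  - by rewrite mem_filter mem_enum andbT.
have [a [t [def_s sz_t at_]]] : exists a t,
    [/\ s = a :: t, size t = k.+1 & path (fun b c => b * c < 0) a t].
  have sz_s : size s = k.+2 by rewrite size_map size_enum_ord.
  have nth_s (i : 'I_k.+2) : nth 0 s i = v 0 (I i).
    by rewrite (nth_map i) ?size_enum_ord // nth_ord_enum.
  clearbody s; case: s sz_s nth_s => // a t [sz_t] nth_s.
  exists a, t; split => //; apply/(pathP 0) => i; rewrite sz_t => ik.
  have := altI (Ordinal (ltnW ik : i < k.+2)%N) (Ordinal (ik : i.+1 < k.+2)%N) erefl.
  by rewrite -!nth_s.
have [t0 ct] := changes_path at_.
have sN0 : all (fun b => b != 0) s.
  rewrite def_s /= t0 andbT; case: t at_ sz_t {def_s t0 ct} => // b t /= /andP[ab _] _.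
  by apply: contraTneq ab => ->; rewrite mul0r ltxx.
rewrite -sz_t -ct -def_s.
apply: subseq_changes; first exact: filter_all.
rewrite subseq_filter sN0 (_ : s = map (v 0) (map I (enum 'I_k.+2))); last exact: map_comp.
exact: map_subseq.
Qed.

(** Converse of [svar_alternating]; [v != 0] supplies the first index, which the bound on [svar]
    does not when [k = 0]. *)
Lemma alternating_svar (k n : nat) (v : 'rV[R]_n) :
  v != 0 -> (k <= svar v)%N ->
  exists2 I : 'I_k.+1 -> 'I_n, increasing I & alternating v I.
Proof.
move=> v0; rewrite /svar filter_map; set e := filter _ _ => ke.
have eN0 : all (fun i => v 0 i != 0) e by exact: filter_all.
have : e != [::].
  apply: contra_neq v0 => e0; apply/rowP => i; rewrite mxE; apply/eqP/negPn/negP => vi.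
  by have : i \in e; [rewrite mem_filter /= vi mem_enum|rewrite e0].
have : sorted (fun i j : 'I_n => (i < j)%N) e.
  apply: sorted_filter; first by move=> ? ? ?; exact: ltn_trans.
  exact: enum_ord_sorted.
case: e ke eN0 => // a e ke aN0 ae _.
have [t [sz te at_]] := changes_subseq aN0 ke.
have tr : transitive (fun i j : 'I_n => i < j)%N by move=> ? ? ?; exact: ltn_trans.
have st : sorted (fun i j : 'I_n => (i < j)%N) (a :: t).
  by apply: (subseq_sorted tr _ ae); rewrite /= eqxx.
exists (fun i : 'I_k.+1 => nth a (a :: t) i).
  by move=> i j; apply: (sorted_ltn_nth tr) => //; rewrite inE /= sz.
move=> i j ij; rewrite ij /=; apply: (pathP a at_).
by rewrite sz; move: (ltn_ord j); rewrite ij.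
Qed.

End SignVariation.

(** * Kernels of matrices whose maximal minors have one sign *)

Section PositiveKernel.
Variable R : realType.

Lemma increasing_lift n (p : 'I_n.+1) : increasing (lift p).
Proof. by move=> i j; rewrite !ltnNge /= leq_bump2. Qed.

Lemma increasing_comp k m n (I : 'I_k -> 'I_m) (J : 'I_m -> 'I_n) :
  increasing I -> increasing J -> increasing (J \o I).
Proof. by move=> incI incJ i j /incI/incJ. Qed.

Lemma mulmx_colsub_lift k n (A : 'M[R]_(k, n.+1)) (l : 'rV[R]_n.+1) p :
  A *m l^T = l 0 p *: col p A + colsub (lift p) A *m (colsub (lift p) l)^T.
Proof.
apply/matrixP => i j; rewrite !mxE (bigD1_ord p) //= !mxE ord1 mulrC; congr (_ + _).
by apply: eq_bigr => q _; rewrite !mxE.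
Qed.

(* Deleting a zero of [l], or merging two adjacent columns on which [l] has the
   same sign, keeps all minors of the same sign and does not increase the sign
   variation of [l]; when neither is possible, [l] alternates everywhere. *)
Lemma positive_ker_alternating (k n : nat) (s : R) (A : 'M[R]_(k, n)) (l : 'rV[R]_n) :
  (k <= n)%N -> (forall I, increasing I -> 0 < s * minor I A) ->
  A *m l^T = 0 -> l != 0 ->
  exists2 I : 'I_k.+1 -> 'I_n, increasing I & alternating l I.
Proof.
elim: n A l => [|n IH] A l kn posA Al l0; first by rewrite thinmx0 eqxx in l0.
move: kn; rewrite leq_eqVlt => /predU1P[kn|kn].
  (* [A] is square and its determinant is a maximal minor, so [A] is invertible and [l = 0]. *)
  exfalso; subst k; move: (posA id (fun i j ij => ij)).
  rewrite /minor (_ : colsub id A = A); last by apply/matrixP => i j; rewrite mxE.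
  move=> /gt_eqF/negbT; rewrite mulf_eq0 => /norP[_ dA].
  have Au : A \in unitmx by rewrite unitmxE unitfE.
  by move: l0; rewrite -[l]trmxK -(mulKmx Au l^T) Al mulmx0 trmx0 eqxx.
have step (J : 'I_n -> 'I_n.+1) (B : 'M[R]_(k, n)) : increasing J ->
    (forall I, increasing I -> 0 < s * minor I B) ->
    B *m (colsub J l)^T = 0 -> colsub J l != 0 ->
    exists2 I : 'I_k.+1 -> 'I_n.+1, increasing I & alternating l I.
  move=> incJ posB Bl Jl0; have [I incI altI] := IH _ _ kn posB Bl Jl0.
  exists (J \o I); first exact: increasing_comp.
  by move=> i j /altI; rewrite !mxE.
have [/existsP[p /eqP lp]|/existsPn lN0] := boolP [exists p, l 0 p == 0].
  apply: (step (lift p) (colsub (lift p) A)); first exact: increasing_lift.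
  - move=> I incI; rewrite (_ : minor _ _ = minor (lift p \o I) A).
      by apply: posA; apply: increasing_comp => //; exact: increasing_lift.
    by congr (\det _); apply/matrixP => i j; rewrite !mxE.
  - by move: Al; rewrite (mulmx_colsub_lift _ _ p) lp scale0r add0r.
  - apply: contra_neq l0 => l'0; apply/rowP => q; rewrite mxE.
    by case: (unliftP p q) => [r|] -> //; move/rowP/(_ r): l'0; rewrite !mxE.
(* [f p] skips column [p + 1] and [g p] skips column [p]; they differ only at [p], where they give
   [p] and [p + 1]. *)
pose f (p : 'I_n) := lift (lift ord0 p); pose g (p : 'I_n) := lift (widen_ord (leqnSn n) p).
have [/existsP[p lp]|/existsPn lalt] :=
    boolP [exists p, 0 < l 0 (f p p) * l 0 (g p p)]; last first.
  (* All neighbours have opposite signs, so the first [k + 1] indices do. *)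
  exists (widen_ord kn) => // i j ij.
  have i_n : (i < n)%N by have := ltn_ord j; lia.
  have := lalt (Ordinal i_n); rewrite -leNgt le_eqVlt mulf_eq0 !(negPf (lN0 _)) /=.
  have -> : f (Ordinal i_n) (Ordinal i_n) = widen_ord kn i.
    by apply: val_inj; rewrite /= /bump; do ?[case: leqP => ?]; lia.
  have -> // : g (Ordinal i_n) (Ordinal i_n) = widen_ord kn j.
  by apply: val_inj; rewrite /= /bump ij; do ?[case: leqP => ?]; lia.
have fg q : q != p -> f p q = g p q.
  by move=> qp; apply: val_inj; move: qp; rewrite -val_eqE /= /bump; do ?[case: leqP => ?]; lia.
have gp : g p p = lift ord0 p by apply: val_inj; rewrite /= /bump; do ?[case: leqP => ?]; lia.
(* This ratio gives [l_p A_p + l_{p+1} A_{p+1} = l_p (A_p + b A_{p+1})], so merging the columns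
   preserves the kernel equation. *)
set b := l 0 (g p p) / l 0 (f p p).
have b0 : 0 < b.
  have f2 : 0 < l 0 (f p p) * l 0 (f p p) by rewrite -expr2 exprn_even_gt0 ?lN0.
  rewrite -(pmulr_lgt0 _ f2) (_ : b * _ = l 0 (f p p) * l 0 (g p p)) //.
  by rewrite /b; field; exact: lN0.
pose B := \matrix_(i, q) (A i (f p q) + (if q == p then b * A i (g p p) else 0)).
apply: (step (f p) B); first exact: increasing_lift.
- move=> I incI.
  have fI : 0 < s * minor (f p \o I) A.
    by apply: posA; apply: increasing_comp => //; exact: increasing_lift.
  have gI : 0 < s * minor (g p \o I) A.
    by apply: posA; apply: increasing_comp => //; exact: increasing_lift.
  have [/existsP[r /eqP Ir]|/existsPn Ip] := boolP [exists r, I r == p]; last first.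
    rewrite (_ : minor I B = minor (f p \o I) A) //; congr (\det _).
    by apply/matrixP => i j; rewrite !mxE (negPf (Ip _)) addr0.
  have Ir' q : q != r -> I q != p.
    rewrite -Ir -!val_eqE !neq_ltn => /orP[] /incI -> //; exact: orbT.
  (* The determinant is linear in the merged column. *)
  have -> : minor I B = minor (f p \o I) A + b * minor (g p \o I) A.
    rewrite /minor -det_tr -[X in X + _]mul1r -[\det (colsub (f p \o I) A)]det_tr.
    rewrite -[\det (colsub (g p \o I) A)]det_tr; apply: (determinant_multilinear (i0 := r)).
    + by apply/rowP => j; rewrite !mxE /= Ir eqxx mul1r.
    + apply/matrixP => i j; rewrite !mxE.
      by rewrite (negPf (Ir' _ _)) ?addr0 // eq_sym neq_lift.
    + apply/matrixP => i j; rewrite !mxE /= -fg ?(negPf (Ir' _ _)) ?addr0 // ?Ir' //;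
      by rewrite eq_sym neq_lift.
  by rewrite mulrDr addr_gt0 // mulrCA mulr_gt0.
- rewrite -[RHS]Al (mulmx_colsub_lift A l (lift ord0 p)) -/(f p).
  have -> : B = colsub (f p) A + \matrix_(i, q) (if q == p then b * A i (g p p) else 0).
    by apply/matrixP => i q; rewrite !mxE.
  rewrite mulmxDl addrC; congr (_ + _); apply/matrixP => i j.
  rewrite !mxE (bigD1 p) //= big1 => [|q qp]; last by rewrite !mxE (negPf qp) mul0r.
  by rewrite !mxE ord1 eqxx addr0 -gp /b; field; exact: lN0.
- apply: contraNneq (lN0 (f p p)) => /rowP/(_ p); rewrite !mxE => ->; exact: eqxx.
Qed.

End PositiveKernel.

(** * Positive matrices that kill a given vector *)

Section PositiveWithKernel.
Variable R : realType.

(** Absorbs the cofactor signs, turning [twistor] into a dot product; for the Plücker vector of a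
    rank [k] matrix it is a normal vector of the row space. *)
Definition alt_col k (x : 'rV[R]_k.+1) : 'cV[R]_k.+1 :=
  \col_j ((-1) ^+ (k - j) * x 0 j).

Lemma twistor_alt_col k (x v : 'rV[R]_k.+1) : twistor x v = (v *m alt_col x) 0 0.
Proof. by rewrite mxE; apply: eq_bigr => j _; rewrite !mxE mulrC. Qed.

Lemma twistor_vec_alt_col k n (Z : 'M[R]_(n, k.+1)) (x : 'rV[R]_k.+1) :
  (twistor_vec Z x)^T = Z *m alt_col x.
Proof.
by apply/colP => i; rewrite !mxE twistor_alt_col !mxE; apply: eq_bigr => j _; rewrite !mxE.
Qed.

Lemma alt_col_eq0 k (x : 'rV[R]_k.+1) : (alt_col x == 0) = (x == 0).
Proof.
apply/eqP/eqP => [x0|->]; last by apply/colP => j; rewrite !mxE mulr0.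
by apply/rowP => j; move/colP/(_ j)/eqP: x0; rewrite !mxE mulf_eq0 signr_eq0 => /eqP.
Qed.

(* The entries are determinants with a repeated column. *)
Lemma mulmx_plucker_vec k (W : 'M[R]_(k, k.+1)) : W *m alt_col (plucker_vec W) = 0.
Proof.
apply/colP => i; rewrite [RHS]mxE.
have -> : (W *m alt_col (plucker_vec W)) i 0 = twistor (plucker_vec W) (row i W).
  by rewrite twistor_alt_col !mxE; apply: eq_bigr => j _; rewrite !mxE.
rewrite twistorE -det_tr; apply: (determinant_alternate (neq_lift ord_max i)) => j.
by rewrite !mxE liftK unlift_none.
Qed.

(** With nodes [0, 1, 2, ...] the minors are Vandermonde determinants, products of positive
    differences. *)
Lemma exists_positive_minors k n :
  exists B : 'M[R]_(k, n), forall I, increasing I -> 0 < minor I B.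
Proof.
exists (Vandermonde k (\row_j (val j)%:R)) => I incI.
rewrite /minor (_ : colsub I _ = Vandermonde k (\row_j (val (I j))%:R)).
  rewrite det_Vandermonde; apply: prodr_gt0 => i _; apply: prodr_gt0 => j ij.
  by rewrite !mxE subr_gt0 ltr_nat incI.
by apply/matrixP => i j; rewrite !mxE.
Qed.

(** Descending induction from the last index, so that the sign matches the one in [alt_col]. *)
Lemma alternating_sign k n (v : 'rV[R]_n) (I : 'I_k.+1 -> 'I_n) (r : 'I_k.+1) :
  (0 < k)%N -> alternating v I ->
  0 < (-1) ^+ (k - r) * v 0 (I r) * v 0 (I ord_max).
Proof.
move=> k0 altI; move Em: (k - r)%N => m; elim: m r Em => [|m IH] r kr.
  have -> : r = ord_max by apply: val_inj => /=; have := ltn_ord r; lia.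
  have k1 : (k.-1 < k.+1)%N by lia.
  have lt0 := altI (Ordinal k1) ord_max (esym (prednK k0)).
  rewrite expr0 mul1r -expr2 exprn_even_gt0 //=.
  by apply: contraTneq lt0 => ->; rewrite mulr0 ltxx.
have r1 : (r.+1 < k.+1)%N by lia.
have lt0 := altI r (Ordinal r1) erefl.
have gt0 : 0 < (-1) ^+ m * v 0 (I (Ordinal r1)) * v 0 (I ord_max) by apply: IH => /=; lia.
set x := v 0 (I r) in lt0 *; set y := v 0 (I (Ordinal r1)) in lt0 gt0.
have y2 : 0 < y * y.
  by rewrite -expr2 exprn_even_gt0 //=; apply: contraTneq lt0 => ->; rewrite mulr0 ltxx.
have : (-1) ^+ m * y * v 0 (I ord_max) * (x * y) < 0 by rewrite pmulr_rlt0.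
have -> : (-1) ^+ m * y * v 0 (I ord_max) * (x * y) =
  - ((-1) ^+ m.+1 * x * v 0 (I ord_max)) * (y * y) by rewrite exprS; ring.
by rewrite pmulr_llt0 // oppr_lt0.
Qed.

Lemma row_free_minor k m (C : 'M[R]_(k, m)) (I : 'I_k -> 'I_m) : minor I C != 0 -> row_free C.
Proof.
move=> C0; rewrite -row_leq_rank.
have rk : \rank (colsub I C) = k by apply: mxrank_unit; rewrite unitmxE unitfE.
rewrite -[leqLHS]rk.
have -> : colsub I C = C *m colsub I 1%:M.
  by rewrite -{1}[C]mulmx1; apply/matrixP => i j; rewrite !mxE; apply: eq_bigr => q _; rewrite !mxE.
exact: mxrankM_maxl.
Qed.

(* The weights differ from 1 only on the image of [I]: there, adding to [l] a
   solution of [C z = - B l] and a large multiple of the kernel vector [c] of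
   [C := colsub I B] kills [B l] without changing signs, as [c] alternates. *)
Lemma exists_positive_weights k n (B : 'M[R]_(k, n)) (l : 'rV[R]_n)
    (I : 'I_k.+1 -> 'I_n) :
  (0 < k)%N -> (forall J, increasing J -> 0 < minor J B) ->
  increasing I -> alternating l I ->
  exists2 d : 'rV[R]_n, (forall j, 0 < d 0 j) & B *m diag_mx d *m l^T = 0.
Proof.
move=> k0 posB incI altI; set C := colsub I B.
have minorC (r : 'I_k.+1) : 0 < minor (lift r) C.
  rewrite (_ : minor _ _ = minor (I \o lift r) B).
    by apply: posB; apply: increasing_comp => //; exact: increasing_lift.
  by congr (\det _); apply/matrixP => i j; rewrite !mxE.
have Cfree : row_free C by apply: (@row_free_minor _ _ _ (lift ord0)); rewrite gt_eqF.
set c := alt_col (plucker_vec C).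
have Cc : C *m c = 0 by exact: mulmx_plucker_vec.
pose z := - (pinvmx C *m (B *m l^T)).
have Cz : C *m z = - (B *m l^T) by rewrite mulmxN mulmxA mulmxVp // mul1mx.
have sgn r := alternating_sign r k0 altI.
have lN0 r : l 0 (I r) != 0.
  by apply: contraTneq (sgn r) => ->; rewrite mulr0 mul0r ltxx.
set e := l 0 (I ord_max) in sgn.
(* [c r] has sign [(-1)^(k - r)], and [l] at [I r] has that sign times the sign of [e]; hence [q r]
   is positive. *)
pose q r := e * c r 0 / l 0 (I r).
have q0 r : 0 < q r.
  have l2 : 0 < l 0 (I r) * l 0 (I r) by rewrite -expr2 exprn_even_gt0 ?lN0.
  rewrite -(pmulr_lgt0 _ l2).
  have -> : q r * (l 0 (I r) * l 0 (I r)) =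
      (-1) ^+ (k - r) * l 0 (I r) * e * minor (lift r) C.
    by rewrite /q /c !mxE; field; exact: lN0.
  exact: mulr_gt0.
(* The sum dominates each term and the final [1] makes this strict: [M * q r] exceeds
   [|1 + z r / l (I r)|] for all [r]. *)
pose M := \sum_r (`|1 + z r 0 / l 0 (I r)| / q r) + 1.
pose w r := z r 0 + M * (e * c r 0).
have I_inj : injective I.
  by move=> i j ij; case: (ltngtP i j) => [/incI|/incI|/val_inj //]; rewrite ij ltnn.
(* Scaling by [d] adds [w r] to the entry of [l] at [I r]; [I] is injective, so at most one [r]
   contributes. *)
pose d := \row_j (1 + \sum_r (if j == I r then w r / l 0 (I r) else 0)).
exists d => [j|].
  rewrite mxE; have [/existsP[r /eqP ->]|/existsPn jI] := boolP [exists r, j == I r]; last first.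
    by rewrite big1 ?addr0 // => r _; rewrite (negPf (jI r)).
  rewrite (bigD1 r) //= eqxx big1 => [|r' r'r]; last by rewrite (inj_eq I_inj) eq_sym (negPf r'r).
  rewrite addr0 /w mulrDl addrA -[X in _ + X]mulrA -/(q r).
  set a := 1 + _; have : `|a| < M * q r.
    rewrite -ltr_pdivrMr // /M (bigD1 r) //= -/a -addrA ltrDl.
    by apply: ltr_wpDl => //; apply: sumr_ge0 => i _; rewrite divr_ge0 // ltW.
  by rewrite ltr_norml => /andP[+ _]; rewrite -subr_gt0 opprK addrC.
have -> : B *m diag_mx d *m l^T = B *m l^T + C *m \col_r w r.
  apply/colP => i; rewrite mul_mx_diag !mxE.
  transitivity (\sum_j (B i j * l 0 j +
      \sum_r (if j == I r then B i (I r) * w r else 0))).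
    apply: eq_bigr => j _; rewrite !mxE mulrDr mulr1 mulrDl; congr (_ + _).
    rewrite mulr_sumr mulr_suml; apply: eq_bigr => r _.
    by case: eqP => [->|_]; [field; exact: lN0|rewrite mulr0 mul0r].
  rewrite big_split /=; congr (_ + _); first by apply: eq_bigr => j _; rewrite mxE.
  rewrite exchange_big /=; apply: eq_bigr => r _.
  by rewrite -big_mkcond big_pred1_eq !mxE.
have -> : \col_r w r = z + (M * e) *: c by apply/colP => r; rewrite !mxE /w mulrA !mxE.
by rewrite mulmxDr -scalemxAr Cc scaler0 addr0 Cz subrr.
Qed.

(** Positive column weights multiply each maximal minor by a positive product. *)
Lemma exists_positive_ker k n (l : 'rV[R]_n) :
  (0 < k)%N -> l != 0 -> (k <= svar l)%N ->
  exists2 A : 'M[R]_(k, n), (forall I, increasing I -> 0 < minor I A) & A *m l^T = 0.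
Proof.
move=> k0 l0 /(alternating_svar l0)[J incJ altJ].
have [B posB] := exists_positive_minors k n.
have [d d0 Bdl] := exists_positive_weights k0 posB incJ altJ.
exists (B *m diag_mx d) => // I incI.
have -> : minor I (B *m diag_mx d) = minor I B * \prod_r d 0 (I r).
  rewrite /minor (_ : colsub I _ = colsub I B *m diag_mx (\row_r d 0 (I r))).
    by rewrite det_mulmx det_diag; congr (_ * _); apply: eq_bigr => r _; rewrite mxE.
  by rewrite !mul_mx_diag; apply/matrixP => i j; rewrite !mxE.
by apply: mulr_gt0; [exact: posB|apply: prodr_gt0].
Qed.

End PositiveWithKernel.

(** * Perturbation away from the base locus *)

Section Perturbation.
Variable R : realType.

(** Continuity at [0], taking the smallest of finitely many radii. *)
Lemma poly_pos_near0 (T : eqType) (s : seq T) (p : T -> {poly R}) :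
  (forall x, x \in s -> 0 < (p x).[0]) ->
  exists2 d, 0 < d & forall t x, 0 < t < d -> x \in s -> 0 < (p x).[t].
Proof.
elim: s => [|x s IH] p0; first by exists 1.
have [|d d0 dP] := IH; first by move=> y ys; apply: p0; rewrite inE ys orbT.
have px : 0 < (p x).[0] by apply: p0; rewrite mem_head.
have [e e0 eP] := poly_cont 0 (p x) px.
exists (Num.min d e) => [|t y /andP[t0]]; first by rewrite lt_min d0.
rewrite lt_min => /andP[td te]; rewrite inE => /predU1P[->|]; last by apply: dP; rewrite t0.
have /eP : `|t - 0| < e by rewrite subr0 gtr0_norm.
by rewrite ltr_norml => /andP[+ _]; rewrite -subr_gt0 opprK subrK.
Qed.

(** Factoring out the power of ['X] leaves [r] with [r.[0] != 0], and [r * r] stays positive near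
    [0]. *)
Lemma poly_neq0_near0 (q : {poly R}) : q != 0 ->
  exists2 d, 0 < d & forall t, 0 < t < d -> q.[t] != 0.
Proof.
move=> q0; have [m [r]] := multiplicity_XsubC q 0; rewrite q0 /= => r0 ->.
have [|d d0 dP] := @poly_pos_near0 unit [:: tt] (fun=> r * r).
  by move=> _ _; rewrite hornerM -expr2 exprn_even_gt0.
exists d => // t /[dup] /andP[t0 _] /dP/(_ (mem_head tt [::])).
rewrite !hornerM horner_exp hornerXsubC subr0 mulf_eq0 expf_eq0 (gt_eqF t0) andbF orbF.
by apply: contraTneq => ->; rewrite mulr0 ltxx.
Qed.

(* Write [A Z = M W] and [W = B Z]: then [(A + t B) Z = (M + t) W] has full
   rank unless [- t] is an eigenvalue of [M]. *)
Lemma perturb_positive k n m (Z : 'M[R]_(n, m)) (A B : 'M[R]_(k, n)) (W : 'M[R]_(k, m)) :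
  (forall I, increasing I -> 0 < minor I A) ->
  (A *m Z <= W)%MS -> B *m Z = W ->
  exists2 t, (forall I, increasing I -> 0 < minor I (A + t *: B)) &
    \rank ((A + t *: B) *m Z) = \rank W.
Proof.
move=> posA /submxP[M AZ] BZ.
(* The minors of [A + t B] as polynomials in [t], indexed by finite functions so that they can be
   enumerated. *)
pose p (I : {ffun 'I_k -> 'I_n}) : {poly R} :=
  \det (\matrix_(i, j) ((A i (I j))%:P + (B i (I j)) *: 'X)).
have pE I t : (p I).[t] = minor I (A + t *: B).
  rewrite /p -horner_evalE -det_map_mx; congr (\det _); apply/matrixP => i j.
  by rewrite !mxE /= horner_evalE hornerD hornerC hornerZ hornerX mulrC.
have [|d d0 dP] := @poly_pos_near0 _
  [seq I : {ffun 'I_k -> 'I_n} <- enum {ffun 'I_k -> 'I_n} | `[<increasing I>]] p.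
  move=> I; rewrite mem_filter => /andP[/asboolP incI _].
  by rewrite pE scale0r addr0; exact: posA.
(* The value of [char_poly (- M)] at [t] is the determinant of [M + t]. *)
have [|e e0 eP] := @poly_neq0_near0 (char_poly (- M)).
  exact/monic_neq0/char_poly_monic.
have [t /andP[t0 td] te] : exists2 t, 0 < t < d & t < e.
  exists (Num.min d e / 2); last by rewrite ltr_pdivrMr // gt_min; apply/orP; right; lra.
  apply/andP; split; first by rewrite divr_gt0 // lt_min d0.
  by rewrite ltr_pdivrMr // gt_min; apply/orP; left; lra.
exists t => [I incI|].
  have incF : increasing [ffun i => I i] by move=> i j; rewrite !ffunE; exact: incI.
  have := dP t [ffun i => I i]; rewrite t0 td mem_filter mem_enum pE.
  rewrite (_ : minor _ _ = minor I (A + t *: B)); last first.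
    by congr (\det _); apply/matrixP => i j; rewrite !mxE ffunE.
  by apply=> //; apply/andP; split=> //; apply/asboolP.
have Mt : M + t%:M \in unitmx.
  have := eP t; rewrite t0 te => /(_ isT); rewrite unitmxE unitfE.
  rewrite -horner_evalE -det_map_mx; congr (\det _ != 0); apply/matrixP => i j.
  by rewrite !mxE /= horner_evalE !hornerE hornerMn hornerX opprK addrC.
rewrite mulmxDl AZ -scalemxAl BZ -mul_scalar_mx -mulmxDl.
by rewrite eqmxMfull // row_full_unit.
Qed.

End Perturbation.

(** * Hyperplanes as points of projective space, and the two inclusions *)

Lemma rank_kermx_col (R : realType) k (y : 'cV[R]_k.+1) : y != 0 -> \rank (kermx y) = k.
Proof. by move=> y0; rewrite mxrank_ker -mxrank_tr rank_rV trmx_eq0 y0 subn1. Qed.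

Lemma exists_kernel_mx (R : realType) k (y : 'cV[R]_k.+1) : y != 0 ->
  exists2 W : 'M[R]_(k, k.+1), \rank W = k & (W :=: kermx y)%MS.
Proof.
move=> /rank_kermx_col rky; have := row_base_free (kermx y); have := eq_row_base (kermx y).
by move: (row_base _); rewrite rky => W Wy /eqP rkW; exists W.
Qed.

Lemma hcoord_line (R : realType) n (x : Proj R n) : <[hcoord x]>%VS = val x.
Proof.
apply/eqP; rewrite eqEdim -memvE memv_pick /= (eqP (valP x)) dim_vline.
by rewrite hcoord_neq0.
Qed.

(** Both [alt_col] vectors lie in the orthogonal complement of a hyperplane, which is a line. *)
Lemma plucker_vec_kernel (R : realType) k (W : 'M[R]_(k, k.+1)) (x : 'rV[R]_k.+1) :
  \rank W = k -> x != 0 -> W *m alt_col x = 0 ->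
  exists2 a, a != 0 & plucker_vec W = a *: x.
Proof.
move=> rkW x0 Wx; have := plucker_vec_neq0 rkW; set p := plucker_vec W => p0.
have sub_ker (z : 'rV[R]_k.+1) : W *m alt_col z = 0 -> ((alt_col z)^T <= kermx W^T)%MS.
  by move=> Wz; apply/sub_kermxP; rewrite -trmx_mul Wz trmx0.
have rk1 (z : 'rV[R]_k.+1) : z != 0 -> \rank (alt_col z)^T = 1%N.
  by move=> z0; rewrite rank_rV trmx_eq0 alt_col_eq0 z0.
have : ((alt_col p)^T <= (alt_col x)^T)%MS.
  apply: submx_trans (sub_ker _ (mulmx_plucker_vec W)) _.
  have /mxrank_leqif_sup[_ <-] := sub_ker x Wx.
  by rewrite rk1 // mxrank_ker mxrank_tr rkW subSnn.
case/sub_rVP => a pa.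
have pE : p = a *: x.
  apply/rowP => j; move/rowP/(_ j): pa; rewrite !mxE mulrCA => /(mulfI _); apply.
  by rewrite signr_eq0.
by exists a => //; apply: contraNneq p0 => a0; rewrite pE a0 scale0r.
Qed.

Theorem proposition3p3 (R : realType) (k n : nat)
  (hk : (1 <= k)%N) (hn : (k.+1 <= n)%N)
  (Z : 'M[R]_(n, k.+1)) (hZ : \rank Z = k.+1) :
  [set plucker X | X in open_Grasstope Z] =
  [set x : Proj R k.+1 | (k <= svar_proj (twistor_pt hZ x))%N].
Proof.
apply/seteqP; split => [_ /= [X [V [[A AV posA] _] ZV] <-]|x /= kx].
  rewrite /plucker svar_twistor_pt; set W := basis_mx X; set l := twistor_vec _ _.
  have /rowspan_eq AZW : rowspan (A *m Z) = rowspan W.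
    rewrite rowspan_basis_mx -rmul_rowspan AV.
    by move: ZV; rewrite /Zmap; case: insubP => // X' _ <- [<-].
  have /submxP[U AZ] : (A *m Z <= W)%MS by rewrite AZW.
  have Al : A *m l^T = 0.
    by rewrite twistor_vec_alt_col mulmxA AZ -mulmxA mulmx_plucker_vec mulmx0.
  have l0 : l != 0 by apply: twistor_vec_neq0 hZ _; exact/plucker_vec_neq0/rank_basis_mx.
  (* The factor [s] covers both signs allowed in [Gr_pos]. *)
  have [s sA] : exists s, forall I, increasing I -> 0 < s * minor I A.
    case: posA => posA; first by exists 1 => I /posA; rewrite mul1r.
    by exists (-1) => I /posA; rewrite mulN1r oppr_gt0.
  have [I incI altI] := positive_ker_alternating (ltnW hn) sA Al l0.
  exact: svar_alternating incI altI.
set v := hcoord x; have v0 : v != 0 := hcoord_neq0 x.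
have {}kx : (k <= svar (twistor_vec Z v))%N by rewrite svar_proj_pt in kx.
have [A posA] := exists_positive_ker hk (twistor_vec_neq0 hZ v0) kx.
rewrite twistor_vec_alt_col mulmxA => AZv.
(* [W] spans the hyperplane corresponding to [x]; it contains the rows of [A Z], whose rank may
   still be below [k]. *)
have [|W rkW Wv] := @exists_kernel_mx _ _ (alt_col v); first by rewrite alt_col_eq0.
have AZW : (A *m Z <= W)%MS by rewrite Wv; exact/sub_kermxP.
(* Full column rank makes [pinvmx Z] a left inverse; this lifts [W] to a perturbation direction. *)
have BZ : W *m pinvmx Z *m Z = W.
  by rewrite -mulmxA mulVpmx ?mulmx1 // -col_leq_rank hZ.
have [t posAt] := perturb_positive posA AZW BZ; rewrite rkW.
set A' := A + _ => rkA'Z.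
have rkA' : \rank A' = k.
  by apply/eqP; rewrite eqn_leq rank_leq_row -[leqLHS]rkA'Z mxrankM_maxl.
have A'Zv : A' *m Z *m alt_col v = 0.
  have /sub_kermxP Wv0 : (W <= kermx (alt_col v))%MS by rewrite Wv.
  by rewrite !mulmxDl AZv -!scalemxAl BZ Wv0 scaler0 addr0.
exists (bracket rkA'Z).
  exists (bracket rkA'); last exact: Zmap_rowspan.
  by split; [exists A' => //; left|rewrite base_locusP Zmap_rowspan].
(* The rows of [A' Z] are still orthogonal to [alt_col v], so its Plücker vector is a multiple of
   [v]. *)
rewrite plucker_bracket; apply: val_inj => /=; rewrite -hcoord_line -/v.
have [a a0 ->] := plucker_vec_kernel rkA'Z v0 A'Zv.
apply/eqP; rewrite eqEsubv -!memvE memvZ ?memv_line //=.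
by apply/vlineP; exists a^-1; rewrite scalerA mulVf // scale1r.
Qed.
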